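(* Let $m,n$ be integers with $mn\neq 0$ and let $K=J(2m,2n)$ be the corresponding genus one two-bridge knot, with knot group $\pi_1(K)=\langle a,b \mid w^n a = b w^n\rangle$, where $w=(ba^{-1})^m(b^{-1}a)^m$. Let $\rho:\pi_1(K)\to SL_2(\mathbb C)$ be a nonabelian representation; up to conjugation, $$\rho(a)=\begin{bmatrix} s & 1\\ 0 & s^{-1}\end{bmatrix},\qquad \rho(b)=\begin{bmatrix} s & 0\\ 2-y & s^{-1}\end{bmatrix},$$ where $s\neq 0$, $y\neq 2$ and $\phi_K(s,y)=0$, with $$\phi_K(s,y)=S_{n-2}(z)-\Big[1-(y+2-x^2)S_{m-1}(y)\big(S_{m-1}(y)-S_{m-2}(y)\big)\Big]S_{n-1}(z),$$ $x=s+s^{-1}$ and $$z=2S_m^2(y)-2yS_m(y)S_{m-1}(y)+\big((2x^2-2)(1-y)+y^2\big)S_{m-1}^2(y).$$ Set $$A=2n\Big(\frac{2m+2S_m(y)S_{m-1}(y)-yS_{m-1}^2(y)}{y+2}\Big),$$ $$B=-4\big(S_m(y)+S_{m-1}(y)\big)^2\Big(\frac{mS_m(y)+(m+1)S_{m-1}(y)}{(y+2)S_{m-1}(y)}\Big)+6mS_m^2(y)+(4+4m-4n-2my)S_m(y)S_{m-1}(y)+(2+2m-4mn-y+2ny+2mny)S_{m-1}^2(y),$$ $$C=-(2mn-1)\big(2S_m(y)-yS_{m-1}(y)\big)^2.$$ Then the adjoint twisted Alexander polynomial of $K$ associated to $\rho$ is $$\Delta_K^{\mathrm{Ad}\ci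rc\rho}(t)=\frac{t-1}{(y+2-x^2)\big(4-x^2+(y-2)(y+2-x^2)S_{m-1}^2(y)\big)}\left(mn\,t^2-\frac{Ax^4+Bx^2+C}{4+(y-2)(y+2-x^2)S_{m-1}^2(y)}\,t+mn\right).$$
   Context: $J(k,l)$ denotes the two-bridge knot/link obtained from a diagram with two twist regions containing $k$ and $l$ half twists respectively (positive = right-handed); the genus one two-bridge knots are exactly the knots $J(2m,2n)$ with $mn\neq0$. $S_k(v)$ are the Chebyshev polynomials of the second kind: $S_0(v)=1$, $S_1(v)=v$, $S_k(v)=vS_{k-1}(v)-S_{k-2}(v)$ for all integers $k$. A representation is nonabelian if its image is a nonabelian subgroup. Twisted Alexander polynomial (Wada): for a deficiency-one presentation $\langle a_1,\dots,a_\ell\mid r_1,\dots,r_{\ell-1}\rangle$ of $\pi_1(K)$, the abelianization $f:\pi_1(K)\to\langle t\rangle\cong\mathbb Z$ (sending meridians to $t$) and a representation $\sigma:\pi_1(K)\to SL_k(\mathbb C)$, let $\Phi:\mathbb Z[F_\ell]\to M_k(\mathbb C[t^{\pm1}])$ be induced by $g\mapsto \sigma(g)f(g)$; let $M$ be the $(\ell-1)\times\ell$ block matrix with entries $\Phi(\partial r_i/\partial a_j)$ (Fox derivatives) and $M_j$ the matrix obtained by deleting the $j$-th column; then $\Delta_K^{\sigma}(t)=\det M_j/\det\Phi(1-a_j)$, well defined up to a unit factor. The adjoint representation $\mathrm{Ad}:SL_2(\mathbb C)\to SL_3(\mathbb C)$ is $\mathrm{Ad}_P(g)=PgP^{-1}$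 acting on $sl_2(\mathbb C)$, and $\Delta_K^{\mathrm{Ad}\circ\rho}$ is Wada's polynomial for $\sigma=\mathrm{Ad}\circ\rho$. The equality in the claim is understood up to multiplication by a factor $\pm t^{3j}$, $j\in\mathbb Z$.
   Formalization: The condition φ_K(s,y)=0 (whose stated z is not tr ρ(w)) is replaced by the relation w^n a = b w^n for the matrices ρ(a), ρ(b) in the stated normal form; all denominators in A, B and the final formula (including y+2 and S_{m-1}(y)) are assumed nonzero. *)

(* Defs.v *)
From HB Require Import structures.
From mathcomp Require Import all_boot all_order all_algebra.
From mathcomp Require Import fraction.
From mathcomp Require Import reals.
From mathcomp Require Import complex.

Set Implicit Arguments.
Unset Strict Implicit.
Unset Printing Implicit Defensive.

Import Order.TTheory GRing.Theory Num.Theory.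
Local Open Scope ring_scope.

(* Chebyshev polynomials of the second kind S_k(v), k an integer:      *)
(* S_0 = 1, S_1 = v, S_k = v S_{k-1} - S_{k-2} for all integers k      *)
(* (so S_{-1} = 0 and S_{-k} = - S_{k-2}).                             *)
Section Cheb.
Variable F : comNzRingType.

Fixpoint chebS_nat (v : F) (k : nat) {struct k} : F :=
  match k with
  | 0%N => 1
  | 1%N => v
  | (k'.+1 as k1).+1 => v * chebS_nat v k1 - chebS_nat v k'
  end.

Definition chebS (k : int) (v : F) : F :=
  match k with
  | Posz k' => chebS_nat v k'
  | Negz 0 => 0
  | Negz k'.+1 => - chebS_nat v k'
  end.
End Cheb.

(* Words in the free group F(a,b): letters are (generator, inverted?) *)
Definition letter := ('I_2 * bool)%type.
Definition word := seq letter.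

Definition gen_a : 'I_2 := ord0.
Definition gen_b : 'I_2 := ord_max.

Definition inv_word (w : word) : word :=
  rev (map (fun l : letter => (l.1, ~~ l.2)) w).

Definition word_pow (w : word) (k : int) : word :=
  match k with
  | Posz k' => flatten (nseq k' w)
  | Negz k' => flatten (nseq k'.+1 (inv_word w))
  end.

Definition knot_w (m : int) : word :=
  word_pow [:: (gen_b, false); (gen_a, true)] m
  ++ word_pow [:: (gen_b, true); (gen_a, false)] m.

Definition knot_relator (m n : int) : word :=
  word_pow (knot_w m) n ++ [:: (gen_a, false)]
  ++ word_pow (knot_w m) (- n) ++ [:: (gen_b, true)].

(* The ring homomorphism Phi : Z[F_2] -> M_k(Q(t)), g |-> sigma(g) f(g) *)
(* with f sending both generators (meridians) to t, and the images of *)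
(* Fox derivatives.  Laurent polynomials C[t^{+-1}] are viewed inside  *)
(* the fraction field of C[t].                                          *)
Section Wada.
Variable K : fieldType.
Local Notation FF := {fraction {poly K}}.
Variable k : nat.
Variable sigma : 'I_2 -> 'M[FF]_k.

Definition tvar : FF := FracField.tofrac ('X : {poly K}).

Definition Phi_letter (l : letter) : 'M[FF]_k :=
  if l.2 then tvar^-1 *: invmx (sigma l.1) else tvar *: sigma l.1.

Definition Phi_word (w : word) : 'M[FF]_k :=
  foldr (fun l acc => Phi_letter l *m acc) 1%:M w.

(* Phi (d x_i^{e} / d x_j):  d x_j/d x_j = 1, d x_j^{-1}/d x_j = -x_j^{-1} *)
Definition fox_letter (j : 'I_2) (l : letter) : 'M[FF]_k :=
  if l.1 == j then (if l.2 then - Phi_letter l else 1%:M) else 0.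

(* Phi (d w / d x_j), via d(uv) = du + u dv *)
Fixpoint fox (j : 'I_2) (w : word) : 'M[FF]_k :=
  match w with
  | [::] => 0
  | l :: w' => fox_letter j l + Phi_letter l *m fox j w'
  end.

(* Wada's invariant for a 2-generator 1-relator presentation <x0,x1 | r>:
   the 1 x 2 block matrix M = (Phi(dr/dx0) Phi(dr/dx1)); deleting the
   j-th block column leaves Phi(dr/dx_{j'}) with j' the other index. *)
Definition other (j : 'I_2) : 'I_2 := if j == gen_a then gen_b else gen_a.

Definition wada2 (r : word) (j : 'I_2) : FF :=
  \det (fox (other j) r) / \det (1%:M - Phi_letter (j, false)).
End Wada.

(* The adjoint representation Ad : SL_2 -> SL_3, Ad_P(g) = P g P^{-1}  *)
(* on sl_2, written in the basis E = [[0,1],[0,0]], H = [[1,0],[0,-1]],*)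
(* F = [[0,0],[1,0]] (column j = coordinates of P B_j P^{-1}).          *)
Section Adjoint.
Variable K : fieldType.

Definition mx2 (p q r u : K) : 'M[K]_2 :=
  \matrix_(i < 2, j < 2)
    if val i == 0%N then (if val j == 0%N then p else q)
    else (if val j == 0%N then r else u).

Definition sl2_basis (j : 'I_3) : 'M[K]_2 :=
  if val j == 0%N then mx2 0 1 0 0
  else if val j == 1%N then mx2 1 0 0 (-1)
  else mx2 0 0 1 0.

Definition sl2_coord (X : 'M[K]_2) (i : 'I_3) : K :=
  if val i == 0%N then X ord0 ord_max
  else if val i == 1%N then X ord0 ord0
  else X ord_max ord0.

Definition Ad (P : 'M[K]_2) : 'M[K]_3 :=
  \matrix_(i < 3, j < 3) sl2_coord (P *m sl2_basis j *m invmx P) i.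

Definition cstF (c : K) : {fraction {poly K}} := FracField.tofrac (c%:P).

Definition Ad_images (rho : 'I_2 -> 'M[K]_2) (i : 'I_2)
  : 'M[{fraction {poly K}}]_3 := map_mx cstF (Ad (rho i)).
End Adjoint.

Definition rho_J (K : fieldType) (s y : K) (i : 'I_2) : 'M[K]_2 :=
  if i == gen_a then mx2 s 1 0 s^-1 else mx2 s 0 (2 - y) s^-1.

Definition eval_word (K : fieldType) (rho : 'I_2 -> 'M[K]_2) (w : word)
  : 'M[K]_2 :=
  foldr (fun l acc => (if l.2 then invmx (rho l.1) else rho l.1) *m acc)
        1%:M w.

Definition is_knot_rep (K : fieldType) (m n : int) (rho : 'I_2 -> 'M[K]_2)
  : Prop :=
  eval_word rho (word_pow (knot_w m) n) *m rho gen_a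
  = rho gen_b *m eval_word rho (word_pow (knot_w m) n).

Section Coeffs.
Variable K : fieldType.
Variables (m n : int) (y : K).
Local Notation Sm := (chebS m y).
Local Notation Sm1 := (chebS (m - 1) y).
Local Notation mK := (m%:~R : K).
Local Notation nK := (n%:~R : K).

Definition adjcoefA : K :=
  2 * nK * ((2 * mK + 2 * Sm * Sm1 - y * Sm1 ^+ 2) / (y + 2)).

Definition adjcoefB : K :=
  - 4 * (Sm + Sm1) ^+ 2 * ((mK * Sm + (mK + 1) * Sm1) / ((y + 2) * Sm1))
  + 6 * mK * Sm ^+ 2
  + (4 + 4 * mK - 4 * nK - 2 * mK * y) * Sm * Sm1
  + (2 + 2 * mK - 4 * mK * nK - y + 2 * nK * y + 2 * mK * nK * y) * Sm1 ^+ 2.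

Definition adjcoefC : K :=
  - (2 * mK * nK - 1) * (2 * Sm - y * Sm1) ^+ 2.
End Coeffs.

(* Main.v *)
Require Import Defs.
From HB Require Import structures.
From mathcomp Require Import all_boot all_order all_algebra.
From mathcomp Require Import fraction.
From mathcomp Require Import reals.
From mathcomp Require Import complex.
From mathcomp Require Import ring.
Import Order.TTheory GRing.Theory Num.Theory.
Set Implicit Arguments.
Unset Strict Implicit.
Unset Printing Implicit Defensive.
Local Open Scope ring_scope.

(** Let [x = s + 1/s], [X = x/2], [al = (y-2)/4], [d = al + 1 - X^2], so that
    [D1 = 4 d]. With [a, b] for the two SL_2 matrices, the elements
    [i = (b-a)/2], [j = (a+b)/2 - X] and [k = j i] anticommute and have nonzero
    scalar squares [i^2 = al], [j^2 = - d]: they form a basis of sl_2 in which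
    [s] no longer appears. With [u = b a^-1], [S = S_(m-1)(y)] and [T] half the
    trace of [u^m], one finds [w = h + 4 S (T k - 2 X al S j)] for a scalar [h],
    and [w^n a = b w^n] holds iff [w^n] is a multiple of [4 T S d + w - h], an
    element of norm [S^2 D1 D2]. Hence [Ad w^n] and [1 + Ad w + ... + Ad w^(n-1)]
    are rational in [X, al, S, T, n].

    Writing now [a, b] for [t Ad a, t Ad b] and setting
    [N = 1 + w + ... + w^(n-1)], [U = 1 + u^-1 + ... + u^(1-m)], Fox calculus
    gives
      [dr/da (1 - a) = (1 - b) N u^m ((b^-1 - 1) U (1 - a) + u^-m N^-1 w^n)].
    The operators [N], [U], [N^-1 w^n] preserve the axis of [w] or [u] and act
    as left multiplication by a quaternion on the orthogonal complement, so the
    determinant is computed by a polynomial identity modulo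
    [T^2 = 1 + 4 al (al + 1) S^2]. *)

(** * Powers and geometric sums with integer exponents *)

Section IntegerSums.
Variable R : unitRingType.
Implicit Types (x : R) (k : int).

Lemma int_two_sided_ind (P : int -> Prop) :
  P 0 -> (forall k, P k <-> P (k + 1)) -> forall k, P k.
Proof.
move=> P0 PS; elim/int_ind => // k Pk.
  by rewrite intS addrC -PS.
by rewrite PS intS opprD addrAC addNr add0r.
Qed.

Lemma exprz_unique x (f : int -> R) : x \is a GRing.unit ->
  f 0 = 1 -> (forall k, f (k + 1) = f k * x) -> forall k, f k = x ^ k.
Proof.
move=> Ux f0 fS; elim/int_two_sided_ind => [|k]; first by rewrite f0 expr0z.
rewrite fS exprzDr // expr1z; split=> [->//|/(mulIr Ux)//].
Qed.

(** The negative branch is forced by [geomzS]: it extends [1 + x + ... + x^(k-1)] to all integers,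
    so that the Fox derivative of [w^k] is [geomz w k] times that of [w] for either sign of [k]. *)
Definition geomz x k : R :=
  match k with
  | Posz i => \sum_(l < i) x ^+ l
  | Negz i => - \sum_(l < i.+1) x ^- l.+1
  end.

Lemma geomz0 x : geomz x 0 = 0.
Proof. exact: big_ord0. Qed.

Lemma geomzS x k : geomz x (k + 1) = geomz x k + x ^ k.
Proof.
case: k => [k|[|k]] /=; first by rewrite addn1 big_ord_recr.
  by rewrite big_ord0 big_ord1 [x ^ _]/= addNr.
by rewrite subn1 [in RHS]big_ord_recr opprD [x ^ _]/= subrK.
Qed.

Lemma geomz_unique x (f : int -> R) :
  f 0 = 0 -> (forall k, f (k + 1) = f k + x ^ k) -> forall k, f k = geomz x k.
Proof.
move=> f0 fS; elim/int_two_sided_ind => [|k]; first by rewrite f0 geomz0.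
by rewrite fS geomzS; split=> [->//|/addIr].
Qed.

End IntegerSums.

(** * Evaluation and Fox calculus of words in a unit ring *)

Section Words.
Variable R : unitRingType.
Variable h : letter -> R.
Hypothesis h_unit : forall l, h l \is a GRing.unit.
Hypothesis h_inv : forall l, h (l.1, ~~ l.2) = (h l)^-1.

Definition wordprod (w : word) : R := foldr (fun l acc => h l * acc) 1 w.

Lemma wordprod_cat w1 w2 : wordprod (w1 ++ w2) = wordprod w1 * wordprod w2.
Proof. by elim: w1 => [|l w1 IH] /=; rewrite ?mul1r // IH mulrA. Qed.

Lemma wordprod_unit w : wordprod w \is a GRing.unit.
Proof. by elim: w => [|l w IH] /=; rewrite ?unitr1 // unitrMl. Qed.

Lemma wordprod_inv w : wordprod (inv_word w) = (wordprod w)^-1.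
Proof.
rewrite /inv_word; elim: w => [|l w IH]; first by rewrite invr1.
rewrite map_cons rev_cons -cats1 wordprod_cat IH /= h_inv mulr1.
by rewrite invrM ?wordprod_unit.
Qed.

Lemma wordprod_pow w k : wordprod (word_pow w k) = wordprod w ^ k.
Proof.
have nat_pow v i : wordprod (flatten (nseq i v)) = wordprod v ^+ i.
  by elim: i => // i IH; rewrite /= wordprod_cat IH exprS.
case: k => k; rewrite [LHS]nat_pow //.
by rewrite wordprod_inv exprVn.
Qed.

Lemma wordprod_pow_opp w k :
  wordprod (word_pow w (- k)) = (wordprod (word_pow w k))^-1.
Proof. by rewrite !wordprod_pow invr_expz. Qed.

Variable dl : letter -> R.
Hypothesis dl_inv : forall l, dl (l.1, ~~ l.2) = - (h l)^-1 * dl l.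

(** The Fox derivation with prescribed values [dl] on letters; [dl_inv] is the rule
    [d(g^-1) = - g^-1 dg]. *)
Fixpoint foxprod (w : word) : R :=
  if w is l :: w' then dl l + h l * foxprod w' else 0.

Lemma foxprod_cat w1 w2 :
  foxprod (w1 ++ w2) = foxprod w1 + wordprod w1 * foxprod w2.
Proof.
by elim: w1 => [|l w1 IH] /=; rewrite ?mul1r ?add0r // IH mulrDr mulrA addrA.
Qed.

Lemma foxprod_inv w : foxprod (inv_word w) = - (wordprod w)^-1 * foxprod w.
Proof.
rewrite /inv_word; elim: w => [|l w IH]; first by rewrite mulr0.
rewrite map_cons rev_cons -cats1 foxprod_cat IH /= wordprod_inv dl_inv mulr0.
rewrite addr0 invrM ?wordprod_unit // mulrDr !mulNr mulrN -!mulrA.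
by rewrite (mulKr (h_unit l)) addrC.
Qed.

Lemma foxprod_pow w k :
  foxprod (word_pow w k) = geomz (wordprod w) k * foxprod w.
Proof.
have nat_pow v i :
    foxprod (flatten (nseq i v)) = (\sum_(l < i) wordprod v ^+ l) * foxprod v.
  elim: i => [|i IH]; first by rewrite big_ord0 mul0r.
  rewrite /= foxprod_cat IH big_ord_recl expr0 mulrDl mul1r mulrA big_distrr.
  by congr (_ + _ * _); apply: eq_bigr => l _; rewrite exprS.
case: k => k; rewrite [LHS]nat_pow //.
rewrite foxprod_inv wordprod_inv mulrA; congr (_ * _).
rewrite /= mulrN big_distrl; congr (- _); apply: eq_bigr => l _.
by rewrite /= -exprSr exprVn.
Qed.

End Words.

(** * Identities for integer geometric sums *)

Section GeometricSumTheory.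
Variable R : unitRingType.
Implicit Types (x c : R) (k : int).

Lemma mulr_geomz x k : x \is a GRing.unit ->
  x * geomz x k = geomz x k + x ^ k - 1.
Proof.
move=> Ux; elim/int_two_sided_ind: k => [|k].
  by rewrite geomz0 expr0z mulr0 add0r subrr.
have -> : x ^ (k + 1) = x * x ^ k by rewrite addrC exprzDr ?expr1z.
rewrite geomzS mulrDr [_ + x ^ k + _ - 1]addrAC.
by split=> [->//|/addIr].
Qed.

Lemma geomz_opp x k : x \is a GRing.unit ->
  geomz x (- k) = - x ^ (- k) * geomz x k.
Proof.
move=> Ux; elim/int_two_sided_ind: k => [|k].
  by rewrite oppr0 geomz0 mulr0.
have eqk : geomz x (- k) = geomz x (- (k + 1)) + x ^ (- (k + 1)).
  by rewrite -geomzS opprD subrK.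
have eqk1 : - x ^ (- (k + 1)) * geomz x (k + 1)
    = - x ^ (- k) * geomz x k - x ^ (- (k + 1)).
  have -> : x ^ (- k) = x ^ (- (k + 1)) * x.
    by rewrite -[X in _ * X]expr1z -exprzDr // opprD subrK.
  rewrite geomzS !mulNr -mulrA mulr_geomz // !mulrDr mulrN1.
  by rewrite !opprD opprK addrK.
rewrite eqk1 eqk; split=> [<-|->]; first by rewrite addrK.
by rewrite subrK.
Qed.

(** For positive [k], both sides are [x + ... + x^k]. *)
Lemma exprzMgeomzV x k : x \is a GRing.unit ->
  x ^ k * geomz x^-1 k = geomz x k * x.
Proof.
move=> Ux; have Uk i : x ^ i \is a GRing.unit by rewrite unitrXz.
have UV : x^-1 \is a GRing.unit by rewrite unitrV.
elim/int_two_sided_ind: k => [|k]; first by rewrite !geomz0 mulr0 mul0r.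
have -> : x ^ (k + 1) * geomz x^-1 (k + 1)
    = x ^ k * geomz x^-1 k + x ^ k * x.
  rewrite exprzDr // expr1z -mulrA.
  have -> : x * geomz x^-1 (k + 1) = geomz x^-1 k + x.
    apply: (mulrI UV); rewrite mulKr // geomzS mulrDr mulr_geomz //.
    by rewrite mulVr // subrK.
  by rewrite mulrDr.
by rewrite geomzS mulrDl; split=> [->//|/addIr].
Qed.

Lemma geomz_conj x c k : x \is a GRing.unit -> c \is a GRing.unit ->
  geomz (c^-1 * x * c) k = c^-1 * geomz x k * c.
Proof.
move=> Ux Uc; apply/esym; move: k.
have Uxc : c^-1 * x * c \is a GRing.unit by rewrite unitrMl // unitrMr ?unitrV.
apply: geomz_unique => [|k]; first by rewrite geomz0 mulr0 mul0r.
rewrite geomzS mulrDr mulrDl; congr (_ + _).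
move: k; apply: exprz_unique => // [|k]; first by rewrite mulr1 mulVr.
by rewrite exprzDr // expr1z -!mulrA mulVKr.
Qed.

End GeometricSumTheory.

(** * The Fox derivative of the knot relator *)

Section KnotRelator.
Variable R : unitRingType.
Variables a b : R.
Hypotheses (Ua : a \is a GRing.unit) (Ub : b \is a GRing.unit).

Definition gen_image (l : letter) : R :=
  let c := if l.1 == gen_a then a else b in if l.2 then c^-1 else c.

Definition gen_fox (j : 'I_2) (l : letter) : R :=
  if l.1 == j then (if l.2 then - gen_image l else 1) else 0.

Lemma gen_image_unit l : gen_image l \is a GRing.unit.
Proof. by rewrite /gen_image; case: ifP; case: ifP; rewrite ?unitrV. Qed.

Lemma gen_image_inv l : gen_image (l.1, ~~ l.2) = (gen_image l)^-1.
Proof. by rewrite /gen_image /=; case: l.2; rewrite ?invrK. Qed.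

Lemma gen_fox_inv j l :
  gen_fox j (l.1, ~~ l.2) = - (gen_image l)^-1 * gen_fox j l.
Proof.
rewrite /gen_fox /=; case: (l.1 == j); last by rewrite mulr0.
rewrite gen_image_inv; case E: l.2 => /=; last by rewrite mulr1.
by rewrite mulrNN mulVr // gen_image_unit.
Qed.

Local Notation wp := (wordprod gen_image).
Local Notation fp j := (foxprod gen_image (gen_fox j)).

Lemma ord2_cases (i : 'I_2) : i = gen_a \/ i = gen_b.
Proof.
by case: i => [[|[|i]] lti] //; [left | right]; apply: val_inj.
Qed.

(** The fundamental formula of Fox calculus. On a word of value 1 it exchanges the derivatives in
    [a] and in [b]. *)
Lemma fox_fundamental w :
  fp gen_a w * (a - 1) + fp gen_b w * (b - 1) = wp w - 1.
Proof.
elim: w => [|[i e] w IH] /=; first by rewrite !mul0r addr0 subrr.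
rewrite !mulrDl -!mulrA addrACA -mulrDr IH.
suff -> : gen_fox gen_a (i, e) * (a - 1) + gen_fox gen_b (i, e) * (b - 1)
   = gen_image (i, e) - 1 by rewrite mulrBr mulr1 addrC addrA subrK.
by case: (ord2_cases i) => ->; case: e;
  rewrite /gen_fox /gen_image /= ?mul1r ?mul0r ?addr0 ?add0r //
    mulrBr mulr1 mulNr mulVr // opprK addrC.
Qed.

Variables m n : int.

Definition tw_u := b * a^-1.
Definition tw_w := tw_u ^ m * (b^-1 * a) ^ m.

Lemma tw_u_unit : tw_u \is a GRing.unit.
Proof. by rewrite unitrMl ?unitrV. Qed.

Lemma tw_w_unit : tw_w \is a GRing.unit.
Proof.
by rewrite unitrMl unitrXz ?tw_u_unit ?unitrMl ?unitrV.
Qed.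

Lemma wordprod_knot_w : wp (knot_w m) = tw_w.
Proof.
rewrite wordprod_cat !(wordprod_pow gen_image_unit gen_image_inv) /=.
by rewrite !mulr1.
Qed.

Hypothesis rep : tw_w ^ n * a = b * tw_w ^ n.

Lemma wordprod_knot_relator : wp (knot_relator m n) = 1.
Proof.
rewrite /knot_relator !wordprod_cat wordprod_pow_opp;
  [|exact: gen_image_unit|exact: gen_image_inv].
rewrite (wordprod_pow gen_image_unit gen_image_inv) wordprod_knot_w /=.
rewrite !mulr1 !mulrA rep -!mulrA mulVKr ?mulrV //.
by rewrite unitrXz ?tw_w_unit.
Qed.

(** Since [b^-1 a = b^-1 u^-1 b], both halves of [w] contribute through the same sum over powers of
    [u^-1]. *)
Lemma fox_knot_w :
  fp gen_a (knot_w m) = tw_u ^ m * (b^-1 - 1) * geomz tw_u^-1 m.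
Proof.
have Uu := tw_u_unit; rewrite foxprod_cat.
rewrite !(foxprod_pow gen_image_unit gen_image_inv (gen_fox_inv gen_a)).
rewrite (wordprod_pow gen_image_unit gen_image_inv) /=.
rewrite /gen_fox /= /gen_image /= !mulr0 !mulr1 !addr0 !add0r mulrN -/tw_u.
have -> : b^-1 * a = b^-1 * tw_u^-1 * b.
  by rewrite /tw_u invrM ?unitrV // invrK mulrA mulrVK.
rewrite geomz_conj ?unitrV // mulrN -exprzMgeomzV // !mulrA mulrK //.
by rewrite mulrBr !mulr1 mulrBl [LHS]addrC.
Qed.

(** By [rep], [w^n a w^-n = b], so the two powers of [w] contribute [(1 - b) N dw]; also
    [w^n (1 - a) = (1 - b) w^n = (1 - b) N r], so [(1 - b) N] factors out on the left. Here [r]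
    plays the role of [N^-1 w^n]. *)
Lemma fox_knot_relator (r : R) : geomz tw_w n * r = tw_w ^ n ->
  fp gen_a (knot_relator m n) * (1 - a) =
  (1 - b) * geomz tw_w n * tw_u ^ m
  * ((b^-1 - 1) * geomz tw_u^-1 m * (1 - a) + tw_u ^ (- m) * r).
Proof.
move=> Hr; have Uu := tw_u_unit; have Uw := tw_w_unit.
have Uwn : tw_w ^ n \is a GRing.unit by rewrite unitrXz.
rewrite /knot_relator !foxprod_cat.
rewrite !(foxprod_pow gen_image_unit gen_image_inv (gen_fox_inv gen_a)).
rewrite !(wordprod_pow gen_image_unit gen_image_inv) wordprod_knot_w /=.
move: fox_knot_w; set D := fp gen_a _ => HD.
rewrite geomz_opp // /gen_fox /= /gen_image /= -(invr_expz tw_w).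
rewrite !(mulr0, addr0, mulr1) !mulNr mulrN; set g := geomz tw_w n.
have -> : g * D + tw_w ^ n * (1 - a * ((tw_w ^ n)^-1 * g * D))
   = (1 - b) * g * D + tw_w ^ n.
  rewrite mulrBr mulr1 !mulrA rep mulrK // !mulrBl mul1r.
  by rewrite addrA addrAC.
rewrite mulrDl.
have -> : tw_w ^ n * (1 - a) = (1 - b) * tw_w ^ n.
  by rewrite mulrBr mulr1 rep mulrBl mul1r.
rewrite -Hr HD [RHS]mulrDr !mulrA; congr (_ + _).
by rewrite -[_ * tw_u ^ m * _]mulrA -exprzDr // subrr mulr1.
Qed.

End KnotRelator.

(** * Chebyshev identities for integer indices *)

Section Chebyshev.
Variable F : comNzRingType.
Implicit Types (v : F) (k : int).

Lemma chebSS k v : chebS (k + 1) v = v * chebS k v - chebS (k - 1) v.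
Proof.
case: k => [[|[|k]]|[|[|k]]] //=; rewrite ?addr0 ?mulr0 ?mulr1 ?subr0 //=.
- by rewrite addn1.
- by rewrite opprK add0r.
- by ring.
by rewrite addn0; ring.
Qed.

Lemma chebS_sqr k v : chebS k v ^+ 2 =
  1 + v * chebS k v * chebS (k - 1) v - chebS (k - 1) v ^+ 2.
Proof.
elim/int_two_sided_ind: k => [|k]; first by rewrite /=; ring.
rewrite chebSS addrK; split=> [norm|/eqP].
  by ring: norm.
rewrite -subr_eq0 => /eqP norm; apply/eqP; rewrite -subr_eq0 -norm.
by apply/eqP; ring.
Qed.

(* The Chebyshev polynomial of the first kind at [h = v / 2], so that
   [g ^ k = chebC k h + chebS (k - 1) (2 * h) * p] for [g = h + p] of norm 1. *)
Definition chebC k (h : F) := chebS k (2 * h) - h * chebS (k - 1) (2 * h).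

(** A Pell equation: the norm of [g^k] is 1 when that of [g = h + p] is. *)
Lemma chebC_sqr k h :
  chebC k h ^+ 2 = 1 + (h ^+ 2 - 1) * chebS (k - 1) (2 * h) ^+ 2.
Proof. by rewrite /chebC; ring: (chebS_sqr k (2 * h)). Qed.

End Chebyshev.

(** * Explicit 3 by 3 matrices *)

Section Matrix3.
Variable L : comNzRingType.

Definition mx3 (a b c d e f g h i : L) : 'M[L]_3 :=
  \matrix_(r, s)
    nth 0 (nth [::] [:: [:: a; b; c]; [:: d; e; f]; [:: g; h; i]] r) s.

Lemma mul_mx3 a b c d e f g h i a' b' c' d' e' f' g' h' i' :
  mx3 a b c d e f g h i * mx3 a' b' c' d' e' f' g' h' i' =
  mx3 (a * a' + b * d' + c * g') (a * b' + b * e' + c * h')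
      (a * c' + b * f' + c * i')
      (d * a' + e * d' + f * g') (d * b' + e * e' + f * h')
      (d * c' + e * f' + f * i')
      (g * a' + h * d' + i * g') (g * b' + h * e' + i * h')
      (g * c' + h * f' + i * i').
Proof.
apply/matrixP => -[[|[|[|?]]] ?] -[[|[|[|?]]] ?] //;
  by rewrite !mxE !big_ord_recl big_ord0 !mxE /=; ring.
Qed.

Lemma add_mx3 a b c d e f g h i a' b' c' d' e' f' g' h' i' :
  mx3 a b c d e f g h i + mx3 a' b' c' d' e' f' g' h' i' =
  mx3 (a + a') (b + b') (c + c') (d + d') (e + e') (f + f')
      (g + g') (h + h') (i + i').
Proof.
by apply/matrixP => -[[|[|[|?]]] ?] -[[|[|[|?]]] ?] //; rewrite !mxE.
Qed.

Lemma opp_mx3 a b c d e f g h i :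
  - mx3 a b c d e f g h i = mx3 (- a) (- b) (- c) (- d) (- e) (- f)
      (- g) (- h) (- i).
Proof.
by apply/matrixP => -[[|[|[|?]]] ?] -[[|[|[|?]]] ?] //; rewrite !mxE.
Qed.

Lemma scale_mx3 t a b c d e f g h i :
  t *: mx3 a b c d e f g h i = mx3 (t * a) (t * b) (t * c) (t * d) (t * e)
      (t * f) (t * g) (t * h) (t * i).
Proof.
by apply/matrixP => -[[|[|[|?]]] ?] -[[|[|[|?]]] ?] //; rewrite !mxE.
Qed.

Lemma one_mx3 : 1 = mx3 1 0 0 0 1 0 0 0 1.
Proof.
by apply/matrixP => -[[|[|[|?]]] ?] -[[|[|[|?]]] ?] //; rewrite !mxE.
Qed.

Lemma det_mx3 a b c d e f g h i : \det (mx3 a b c d e f g h i) =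
  a * (e * i - f * h) - b * (d * i - f * g) + c * (d * h - e * g).
Proof.
rewrite (expand_det_row _ ord0) !big_ord_recl big_ord0 /cofactor.
rewrite !(expand_det_row _ ord0) !big_ord_recl !big_ord0 /cofactor.
by rewrite !det_mx11 !mxE /= /bump /=; ring.
Qed.

Definition mx3E :=
  (one_mx3, scale_mx3, opp_mx3, mul_mx3, add_mx3).

End Matrix3.

(** * Quaternions of norm 1 and the knot words [u] and [w] *)

Definition qsq (L : comNzRingType) (al d p1 p2 p3 : L) :=
  al * p1 ^+ 2 - d * p2 ^+ 2 + al * d * p3 ^+ 2.

(* [q g0 g1 g2 g3] stands for the image of [g0 + g1 i + g2 j + g3 k] under a
   multiplicative map from the quaternion algebra with [i^2 = al], [j^2 = - d]
   and [k = j i], in which [(p1 i + p2 j + p3 k)^2 = qsq al d p1 p2 p3]. *)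
Definition quat_morph (L : fieldType) (al d : L) (R : unitRingType)
    (q : L -> L -> L -> L -> R) :=
  q 1 0 0 0 = 1 /\
  (forall g0 g1 g2 g3 h0 h1 h2 h3,
    q g0 g1 g2 g3 * q h0 h1 h2 h3 =
    q (g0 * h0 + al * g1 * h1 - d * g2 * h2 + al * d * g3 * h3)
      (g0 * h1 + g1 * h0 - d * g2 * h3 + d * g3 * h2)
      (g0 * h2 + g2 * h0 - al * g1 * h3 + al * g3 * h1)
      (g0 * h3 + g3 * h0 + g2 * h1 - g1 * h2)).

Section QuaternionMorphism.
Variable L : fieldType.
Variables al d : L.
Variable R : unitRingType.
Variable q : L -> L -> L -> L -> R.
Hypothesis q_morph : quat_morph al d q.
Let q1 := proj1 q_morph.
Let qM := proj2 q_morph.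

Lemma quat_morphV g0 g1 g2 g3 : g0 ^+ 2 - qsq al d g1 g2 g3 = 1 ->
  q g0 g1 g2 g3 \is a GRing.unit
  /\ (q g0 g1 g2 g3)^-1 = q g0 (- g1) (- g2) (- g3).
Proof.
move=> nrd1.
(* The sign [e] lets one computation give both the left and the right inverse. *)
have eqM e : e ^+ 2 = 1 ->
    q g0 (e * g1) (e * g2) (e * g3)
    * q g0 (- e * g1) (- e * g2) (- e * g3) = 1.
  move=> e2; rewrite qM -q1 -nrd1 /qsq.
  by congr q; ring: e2.
have rV : q g0 g1 g2 g3 * q g0 (- g1) (- g2) (- g3) = 1.
  by have := eqM 1 (expr1n _ _); rewrite !mul1r !mulN1r.
have lV : q g0 (- g1) (- g2) (- g3) * q g0 g1 g2 g3 = 1.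
  by have := eqM (-1) (sqrr_sign _ 1); rewrite opprK !mul1r !mulN1r.
have U : q g0 g1 g2 g3 \is a GRing.unit.
  by apply/unitrP; exists (q g0 (- g1) (- g2) (- g3)).
by split=> //; apply: (mulrI U); rewrite rV mulrV.
Qed.

Lemma quat_morph_exprz h p1 p2 p3 k :
  qsq al d p1 p2 p3 = h ^+ 2 - 1 ->
  q h p1 p2 p3 ^ k =
  q (chebC k h) (chebS (k - 1) (2 * h) * p1) (chebS (k - 1) (2 * h) * p2)
    (chebS (k - 1) (2 * h) * p3).
Proof.
move=> nrd1; apply/esym; move: k; apply: exprz_unique => [||k].
- by apply: (proj1 (quat_morphV _)); rewrite nrd1 opprB addrC subrK.
- by rewrite /chebC /= mulr0 subr0 !mul0r q1.
rewrite qM /chebC chebSS addrK.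
have dp2 : d * p2 ^+ 2 = al * p1 ^+ 2 + al * d * p3 ^+ 2 + 1 - h ^+ 2.
  have -> : h ^+ 2 = qsq al d p1 p2 p3 + 1 by rewrite nrd1 subrK.
  by rewrite /qsq; ring.
by congr q; ring: dp2.
Qed.

End QuaternionMorphism.

(* [x = 2 X] and [y = 4 al + 2]; the quaternions [X - i + j] and [X + i + j]
   are the images of the two meridians. *)
Section KnotQuaternions.
Variable L : fieldType.
Variables X al : L.
Local Notation d := (al + 1 - X ^+ 2).
Variable R : unitRingType.
Variable q : L -> L -> L -> L -> R.
Hypothesis q_morph : quat_morph al d q.
Let qM := proj2 q_morph.
Variable m : int.
Local Notation S := (chebS (m - 1) (2 * (2 * al + 1))).
Local Notation T := (chebC m (2 * al + 1)).

Local Notation a := (q X (-1) 1 0).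
Local Notation b := (q X 1 1 0).

Lemma nrd_a : X ^+ 2 - qsq al d (-1) 1 0 = 1.
Proof. by rewrite /qsq; ring. Qed.

Lemma nrd_b : X ^+ 2 - qsq al d 1 1 0 = 1.
Proof. by rewrite /qsq; ring. Qed.

Lemma nrd_u : qsq al d (2 * X) 0 2 = (2 * al + 1) ^+ 2 - 1.
Proof. by rewrite /qsq; ring. Qed.

Lemma nrd_v : qsq al d (- (2 * X)) 0 2 = (2 * al + 1) ^+ 2 - 1.
Proof. by rewrite /qsq; ring. Qed.

Lemma nrd_w : qsq al d 0 (- (8 * X * al * S ^+ 2)) (4 * T * S)
  = (1 + 8 * al * d * S ^+ 2) ^+ 2 - 1.
Proof.
by have := chebC_sqr m (2 * al + 1); rewrite /qsq; move: T => T' T2; ring: T2.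
Qed.

Lemma quat_tw_u : tw_u a b = q (2 * al + 1) (2 * X) 0 2.
Proof.
by rewrite /tw_u (proj2 (quat_morphV q_morph nrd_a)) qM; congr q; ring.
Qed.

Lemma quat_tw_v : b^-1 * a = q (2 * al + 1) (- (2 * X)) 0 2.
Proof. by rewrite (proj2 (quat_morphV q_morph nrd_b)) qM; congr q; ring. Qed.

(** The factors [u] and [b^-1 a] have the same scalar part and [k]-coordinate and opposite
    [i]-coordinates, so the [i]-coordinate of the product of their powers cancels. *)
Lemma quat_tw_w : tw_w a b m =
  q (1 + 8 * al * d * S ^+ 2) 0 (- (8 * X * al * S ^+ 2)) (4 * T * S).
Proof.
rewrite /tw_w quat_tw_u quat_tw_v.
rewrite !(quat_morph_exprz q_morph) ?nrd_u ?nrd_v // qM.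
have := chebC_sqr m (2 * al + 1).
by move: T => T' T2; congr q; ring: T2.
Qed.

End KnotQuaternions.

(** * Operators on pure quaternions that preserve an axis *)

Section QuaternionConjugation.
Variable L : fieldType.
Variables al d : L.

(* The matrix in the basis [i, j, k] of
   [X |-> c1 X + c2 (p X - X p) / 2 + c3 (p X + X p) / 2 p]. *)
Definition axlin p1 p2 p3 c1 c2 c3 : 'M[L]_3 :=
  mx3 (c1 + c3 * p1 * (al * p1))
      (c2 * (d * p3) - c3 * p1 * (d * p2))
      (c3 * p1 * (al * d * p3) - c2 * (d * p2))
      (c2 * (al * p3) + c3 * p2 * (al * p1))
      (c1 - c3 * p2 * (d * p2))
      (c3 * p2 * (al * d * p3) - c2 * (al * p1))
      (c2 * p2 + c3 * p3 * (al * p1))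
      (- (c2 * p1) - c3 * p3 * (d * p2))
      (c1 + c3 * p3 * (al * d * p3)).

(* [X |-> g X g^bar] for [g = g0 + p] *)
Definition qconj g0 p1 p2 p3 :=
  axlin p1 p2 p3 (g0 ^+ 2 + qsq al d p1 p2 p3) (2 * g0) (- 2).

Lemma qconj_morph : quat_morph al d qconj.
Proof.
by split=> *; rewrite /qconj /axlin ?one_mx3 ?mul_mx3 /qsq; congr mx3; ring.
Qed.

Lemma qconj_scale c g0 g1 g2 g3 :
  qconj (c * g0) (c * g1) (c * g2) (c * g3) = c ^+ 2 *: qconj g0 g1 g2 g3.
Proof. by rewrite /qconj /axlin scale_mx3 /qsq; congr mx3; ring. Qed.

Lemma det_qconj g0 g1 g2 g3 :
  \det (qconj g0 g1 g2 g3) = (g0 ^+ 2 - qsq al d g1 g2 g3) ^+ 3.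
Proof. by rewrite /qconj /axlin det_mx3 /qsq; ring. Qed.

(* The operator acting by [l] on the line of [p] and as left multiplication
   by [c1 + c2 p] on its orthogonal complement. *)
Definition axial p1 p2 p3 c1 c2 l :=
  axlin p1 p2 p3 c1 c2 ((l - c1) / qsq al d p1 p2 p3).

Section Axial.
Variables p1 p2 p3 : L.
Let P := qsq al d p1 p2 p3.
Hypothesis P0 : P != 0.
Local Notation ax := (axial p1 p2 p3).

(** On the orthogonal complement the operators multiply as in the commutative algebra generated by
    [p], with [p^2 = P]. *)
Lemma axialM c1 c2 l e1 e2 l' :
  ax c1 c2 l * ax e1 e2 l' =
  ax (c1 * e1 + c2 * e2 * P) (c1 * e2 + c2 * e1) (l * l').
Proof.
move: P0; rewrite /axial -/P /axlin mul_mx3 => Pn0.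
by rewrite /P /qsq in Pn0 *; congr mx3; field.
Qed.

Lemma axialD c1 c2 l e1 e2 l' :
  ax c1 c2 l + ax e1 e2 l' = ax (c1 + e1) (c2 + e2) (l + l').
Proof. by rewrite /axial /axlin add_mx3; congr mx3; ring. Qed.

Lemma axial0 : ax 0 0 0 = 0.
Proof. by rewrite -[RHS](subrr 1) !mx3E /axial /axlin; congr mx3; ring. Qed.

Lemma axial_scale e c1 c2 l : e != 0 ->
  axial (e * p1) (e * p2) (e * p3) c1 c2 l = ax c1 (e * c2) l.
Proof.
move=> e0; rewrite /axial.
have -> : qsq al d (e * p1) (e * p2) (e * p3) = e ^+ 2 * P.
  by rewrite /P /qsq; ring.
by rewrite -/P /axlin; congr mx3; field; rewrite e0 P0.
Qed.

Lemma det_axial c1 c2 l : \det (ax c1 c2 l) = l * (c1 ^+ 2 - c2 ^+ 2 * P).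
Proof.
move: P0; rewrite /axial -/P /axlin det_mx3 => Pn0.
by rewrite /P /qsq in Pn0 *; field.
Qed.

(** A pure [X] orthogonal to [p] anticommutes with it. With [g = c + e p] and conjugate [g'], this
    gives [X g' = g X], hence [g X g' = g^2 X]; on the axis the operator is the norm of [g]. *)
Lemma qconj_axial c e :
  qconj c (e * p1) (e * p2) (e * p3) =
  ax (c ^+ 2 + e ^+ 2 * P) (2 * c * e) (c ^+ 2 - e ^+ 2 * P).
Proof.
move: P0; rewrite /qconj /axial -/P /axlin => Pn0.
by rewrite /P /qsq in Pn0 *; congr mx3; field.
Qed.

End Axial.
End QuaternionConjugation.

(** * Powers and geometric sums of a conjugation *)

Section QuaternionPowers.
Variable L : fieldType.
Variables al d h p1 p2 p3 : L.
Local Notation P := (qsq al d p1 p2 p3).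
Local Notation g := (qconj al d h p1 p2 p3).
Hypothesis nrd1 : P = h ^+ 2 - 1.
Hypothesis P0 : P != 0.

Lemma qconj_exprz_axial k : let S := chebS (k - 1) (2 * h) in
  g ^ k =
  axial al d p1 p2 p3 (chebC k h ^+ 2 + S ^+ 2 * P) (2 * chebC k h * S) 1.
Proof.
cbv zeta; rewrite (quat_morph_exprz (qconj_morph al d)) // qconj_axial //.
by congr axial; rewrite chebC_sqr nrd1; ring.
Qed.

(** On the complement the sum of the [g^(2i)] is [S g^(k-1) = S (C + S p) (h - p)]; on the axis each
    term is 1. *)
Lemma geomz_qconj k :
  let S := chebS (k - 1) (2 * h) in let C := chebC k h in
  geomz g k =
  axial al d p1 p2 p3 (S * (C * h - S * P)) (S * (S * h - C)) k%:~R.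
Proof.
cbv zeta; apply/esym; move: k; apply: geomz_unique => [|k].
  by rewrite /= !mul0r; exact: axial0.
rewrite qconj_exprz_axial // axialD intrD nrd1 /chebC addrK chebSS.
have := chebS_sqr k (2 * h).
move: (chebS k _) (chebS (k - 1) _) => S1 S0 normS.
by congr axial; ring: normS.
Qed.

Variables (k : int) (c : L).
Hypothesis chebCc : chebC k h = chebS (k - 1) (2 * h) * c.

(** By [chebCc], [g^k = S (c + p)], and its norm is 1. *)
Lemma chebS_sqr_inv : chebS (k - 1) (2 * h) ^+ 2 * (c ^+ 2 - P) = 1.
Proof.
rewrite mulrBr -exprMn -chebCc nrd1 chebC_sqr [X in _ - X]mulrC.
by rewrite addrK.
Qed.

(** On the complement the quotient of [g^(2k)] by [S g^(k-1)] is [g^(k+1) / S = (c + p) (h + p)]. *)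
Lemma geomz_qconj_div : k%:~R != 0 :> L ->
  geomz g k * axial al d p1 p2 p3 (c * h + P) (c + h) k%:~R^-1 = g ^ k.
Proof.
move=> k0; rewrite geomz_qconj qconj_exprz_axial // axialM // divff //.
by rewrite chebCc nrd1; congr axial; ring.
Qed.

Lemma det_geomz_qconj : \det (geomz g k) * (c ^+ 2 - P) = k%:~R.
Proof.
transitivity (k%:~R * (chebS (k - 1) (2 * h) ^+ 2 * (c ^+ 2 - P)) ^+ 2).
  by rewrite geomz_qconj det_axial // chebCc nrd1; ring.
by rewrite chebS_sqr_inv expr1n mulr1.
Qed.

End QuaternionPowers.

(** * The polynomial identity for the remaining determinant *)

Section KnotDeterminant.
Variable L : fieldType.
Variables X al S T t mu ka : L.
Local Notation d := (al + 1 - X ^+ 2).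
Local Notation Q := (qconj al d).
Hypothesis T2 : T ^+ 2 = 1 + 4 * al * (al + 1) * S ^+ 2.

Let h := 1 + 8 * al * d * S ^+ 2.
Let c1 := S * (T * (2 * al + 1) - 4 * S * al * (al + 1)).
Let r1 := (4 * T * S * d + h) * h - 1.
(** The axis eigenvalues of [U] and [N^-1 w^n], later specialised to [m] and [1/n]. Parametrising
    them by [mu] and [ka] keeps every entry polynomial. *)
Let m := c1 + mu * (al * (al + 1)).
Let nV := r1 + ka * (al * d * (1 + 4 * al * d * S ^+ 2)).

(* [S] times the middle coefficient of the twisted polynomial, divided by [n];
   found by dividing the determinant below by its other factors. *)
Definition core_coef :=
  2 * S ^+ 2 * T * (1 - 8 * X ^+ 2 + 8 * X ^+ 4 - 4 * al * X ^+ 2)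
  + 8 * al * S ^+ 3 * (3 * (al + 1) - 2 * X ^+ 2 * (al + 2))
  + 32 * al * d * (d - X ^+ 2) * S ^+ 4 * T
  + 64 * al ^+ 2 * (al + 1) * d * S ^+ 5
  + (8 * X ^+ 4 * S - 2 * S * (al + 1) * (1 + 2 * X ^+ 2)
     - 16 * al * d * X ^+ 2 * S ^+ 2 * (T + 2 * (al + 1) * S)) * (al * mu)
  + (S * (1 + 4 * al * (al + 1) * S ^+ 2) * (1 - 2 * X ^+ 2)
     + 4 * X ^+ 2 * al * S ^+ 2 * T) * (al * d * ka)
  - X ^+ 2 * T * (al * mu) * (al * d * ka).

(** The matrix is the bracket in the factored Fox derivative, multiplied by [t] to clear [b^-1]. *)
Lemma det_knot_core :
  \det ((Q X (-1) (-1) 0 - t *: 1)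
          * axlin al d (- X) 0 (-1) c1 (2 * S * (S * (2 * al + 1) - T)) mu
          * (1 - t *: Q X (-1) 1 0)
        + t *: (Q T (- (2 * S * X)) 0 (- (2 * S))
          * axlin al d 0 (- (2 * X * al * S)) T
              r1 (4 * S * (4 * T * S * d + h)) ka)) =
  S * (t - 1) ^+ 2 * (t ^+ 2 - (4 * X ^+ 2 - 2) * t + 1) *
  (S * m * (t ^+ 2 + 1) - core_coef * t).
Proof.
(* Entries reduced modulo [T2] before the determinant is expanded. *)
pose p := X * (2 * S * T - 4 * al * S ^+ 2 + al * mu).
pose q0 := 2 * S * T * (1 - 2 * X ^+ 2).
pose e11 := S * T * (1 + t ^+ 2)
  + t * (q0 + 4 * al * X ^+ 2 * S ^+ 2
    * (8 * d * S * T + 16 * al * d * S ^+ 2 + al * d * ka)).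
pose e21 := 2 * X * S ^+ 2 * (1 + t ^+ 2)
  + t * X * (4 * S ^+ 2 * (4 * d - 1 - 2 * al) + 32 * al * d * S ^+ 3 * T
    + 64 * al * (al + 1) * d * S ^+ 4 + 2 * S * T * (al * d * ka)).
pose e22 := (S * T * (1 - 2 * d) + 4 * al * d * S ^+ 2 - d * (al * mu))
    * (1 + t ^+ 2)
  + t * (q0 + 24 * al * d * S ^+ 2 + 32 * al * (al + 1) * d * S ^+ 3 * T
    + 64 * al ^+ 2 * (al + 1) * d * S ^+ 4
    + al * d * ka * (1 + 4 * al * (al + 1) * S ^+ 2) - 2 * d * (al * mu)).
transitivity (\det (mx3
    ((1 - t) ^+ 2 * (S * T * (2 * X ^+ 2 - 1) - 4 * al * X ^+ 2 * S ^+ 2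
      + al * mu * X ^+ 2))
    (2 * d * S ^+ 2 * (1 - t ^+ 2)) (d * p * (1 - t ^+ 2))
    (- (2 * al * S ^+ 2 * (1 - t ^+ 2))) e11 (al * e21)
    (- (p * (1 - t ^+ 2))) e21 e22)).
  congr (\det _).
  rewrite /qconj /axlin !mx3E.
  rewrite /e11 /e21 /e22 /p /q0 /c1 /r1 /h /qsq.
  by congr mx3; ring: T2.
rewrite det_mx3 /e11 /e21 /e22 /p /q0 /m /core_coef /c1.
by ring: T2.
Qed.

(** The prefactor clears the denominators [y + 2] and [D3]. As [nV] becomes [1/n], its multiples are
    the terms of [B] and [C] free of [n]. *)
Lemma core_coefE : let Sm := T + (2 * al + 1) * S in let y := 4 * al + 2 in
  (al + 1) * (1 + 4 * al * d * S ^+ 2) * core_coef =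
  4 * S * (m + Sm * S - (2 * al + 1) * S ^+ 2) * X ^+ 4
  + S * (al + 1) * (- 4 * Sm * S + (- 4 * m + 2 * y + 2 * m * y) * S ^+ 2)
    * X ^+ 2
  - 2 * m * S * (al + 1) * T ^+ 2
  + ((- (Sm + S) ^+ 2 * (m * Sm + (m + 1) * S)
     + S * (al + 1) * (6 * m * Sm ^+ 2 + (4 + 4 * m - 2 * m * y) * Sm * S
       + (2 + 2 * m - y) * S ^+ 2)) * X ^+ 2
     + S * (al + 1) * T ^+ 2) * nV.
Proof. by rewrite /m /nV /r1 /c1 /h /core_coef; ring: T2. Qed.

End KnotDeterminant.

(** * Wada's quotient in quaternion coordinates *)

Section KnotWada.
Variable L : fieldType.
Variables (X al t : L) (m n : int).
Local Notation d := (al + 1 - X ^+ 2).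
Local Notation Q := (qconj al d).
Local Notation x := (2 * X).
Local Notation y := (2 * (2 * al + 1)).
Local Notation S := (chebS (m - 1) y).
Local Notation T := (chebC m (2 * al + 1)).
Local Notation h := (1 + 8 * al * d * S ^+ 2).
Local Notation D1 := (y + 2 - x ^+ 2).
Local Notation D2 := (4 - x ^+ 2 + (y - 2) * D1 * S ^+ 2).
Local Notation D3 := (4 + (y - 2) * D1 * S ^+ 2).

Definition qA := Q X (-1) 1 0.
Definition qB := Q X 1 1 0.
Local Notation a := (t *: qA).
Local Notation b := (t *: qB).

Let Qmorph := qconj_morph al d.
Let QM := proj2 Qmorph.
Let nrdw := nrd_w X al m.

Lemma qA_unit : qA \is a GRing.unit.
Proof. exact: (proj1 (quat_morphV Qmorph (nrd_a _ _))). Qed.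

Lemma qB_unit : qB \is a GRing.unit.
Proof. exact: (proj1 (quat_morphV Qmorph (nrd_b _ _))). Qed.

Hypothesis t_neq0 : t != 0.

Let Ut : t \is a GRing.unit.
Proof. by rewrite unitfE. Qed.

Let Ua : a \is a GRing.unit.
Proof. by rewrite scaler_unit // qA_unit. Qed.

Let Ub : b \is a GRing.unit.
Proof. by rewrite scaler_unit // qB_unit. Qed.

Lemma tw_uE : tw_u a b = Q (2 * al + 1) (2 * X) 0 2.
Proof.
rewrite -(quat_tw_u Qmorph) /tw_u (invrZ Ut qA_unit) -scalerAl -scalerAr.
by rewrite scalerA divff // scale1r.
Qed.

Lemma tw_wE :
  tw_w a b m = Q h 0 (- (8 * X * al * S ^+ 2)) (4 * T * S).
Proof.
rewrite -(quat_tw_w Qmorph) /tw_w tw_uE (quat_tw_u Qmorph) (invrZ Ut qB_unit).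
by rewrite -scalerAl -scalerAr scalerA mulVf // scale1r.
Qed.

Local Notation c := (4 * T * S * d).
Hypothesis chebCc : chebC n h = chebS (n - 1) (2 * h) * c.

Lemma tw_rep : tw_w a b m ^ n * a = b * tw_w a b m ^ n.
Proof.
rewrite tw_wE (quat_morph_exprz Qmorph) // chebCc qconj_scale.
set W := Q c _ _ _.
have WA : W * qA = qB * W by rewrite !QM; congr qconj; ring.
by rewrite -!scalerAl -!scalerAr WA !scalerA mulrC.
Qed.

Hypotheses (y2_neq0 : y - 2 != 0) (y2p_neq0 : y + 2 != 0) (S_neq0 : S != 0).
Hypotheses (D1_neq0 : D1 != 0) (D2_neq0 : D2 != 0) (D3_neq0 : D3 != 0).
Hypothesis n_neq0 : n%:~R != 0 :> L.

Let y2E : y - 2 = 4 * al. Proof. by ring. Qed.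
Let y2pE : y + 2 = 4 * (al + 1). Proof. by ring. Qed.
Let D1E : D1 = 4 * d. Proof. by ring. Qed.
Let D3E : D3 = 4 * (1 + 4 * al * d * S ^+ 2). Proof. by ring. Qed.

(** Both factors of [y - 2 = 4 al] are nonzero, which also excludes characteristic 2. *)
Let al_neq0 : 4 != 0 :> L /\ al != 0.
Proof. by apply/andP; move: y2_neq0; rewrite y2E mulf_eq0 negb_or. Qed.

Let n4 := proj1 al_neq0.

Let al1_neq0 : al + 1 != 0.
Proof. by move: y2p_neq0; rewrite y2pE mulf_eq0 negb_or => /andP[]. Qed.

Let d_neq0 : d != 0.
Proof. by move: D1_neq0; rewrite D1E mulf_eq0 negb_or => /andP[]. Qed.

Let E3_neq0 : 1 + 4 * al * d * S ^+ 2 != 0.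
Proof. by move: D3_neq0; rewrite D3E mulf_eq0 negb_or => /andP[]. Qed.

Let PuE : qsq al d (- X) 0 (-1) = al * (al + 1).
Proof. by rewrite /qsq; ring. Qed.

Let PwE : qsq al d 0 (- (2 * X * al * S)) T
  = al * d * (1 + 4 * al * d * S ^+ 2).
Proof.
by have := chebC_sqr m (2 * al + 1); rewrite /qsq; move: T => T' T2; ring: T2.
Qed.

Let e_neq0 : 4 * S != 0.
Proof. by rewrite mulf_neq0. Qed.

Let nrdw_scale : qsq al d 0 (- (8 * X * al * S ^+ 2)) (4 * T * S)
  = (4 * S) ^+ 2 * (al * d * (1 + 4 * al * d * S ^+ 2)).
Proof. by rewrite -PwE /qsq; ring. Qed.

Let Pw_neq0 : qsq al d 0 (- (8 * X * al * S ^+ 2)) (4 * T * S) != 0.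
Proof. by rewrite nrdw_scale !mulf_neq0 ?expf_neq0 // (proj2 al_neq0). Qed.

Let csubP : c ^+ 2 - qsq al d 0 (- (8 * X * al * S ^+ 2)) (4 * T * S)
  = S ^+ 2 * D1 * D2.
Proof.
by have := chebC_sqr m (2 * al + 1); rewrite nrdw; move: T => T' T2; ring: T2.
Qed.

Lemma det_geomz_tw_w : \det (geomz (tw_w a b m) n) = n%:~R / (S ^+ 2 * D1 * D2).
Proof.
rewrite -csubP tw_wE -(det_geomz_qconj nrdw Pw_neq0 chebCc) mulfK //.
by rewrite csubP !mulf_neq0 ?expf_neq0.
Qed.

Lemma det_sub1_qA : \det (1 - a) = (1 - t) * (t ^+ 2 - (x ^+ 2 - 2) * t + 1).
Proof. by rewrite /qA /qconj /axlin !mx3E det_mx3 /qsq; ring. Qed.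

Lemma det_sub1_qB : \det (1 - b) = (1 - t) * (t ^+ 2 - (x ^+ 2 - 2) * t + 1).
Proof. by rewrite /qB /qconj /axlin !mx3E det_mx3 /qsq; ring. Qed.

Let nrdu : (2 * al + 1) ^+ 2 - qsq al d (2 * X) 0 2 = 1.
Proof. by rewrite nrd_u opprB addrC subrK. Qed.

Let nrduV : qsq al d (- (2 * X)) 0 (-2) = (2 * al + 1) ^+ 2 - 1.
Proof. by rewrite /qsq; ring. Qed.

Let uV : (tw_u a b)^-1 = Q (2 * al + 1) (- (2 * X)) 0 (-2).
Proof. by rewrite tw_uE (proj2 (quat_morphV Qmorph nrdu)) oppr0. Qed.

Lemma det_tw_u_exprz : \det (tw_u a b ^ m) = 1.
Proof.
rewrite tw_uE (quat_morph_exprz Qmorph) ?nrd_u // det_qconj.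
rewrite -[RHS](expr1n _ 3); congr (_ ^+ 3); rewrite chebC_sqr /qsq.
by ring.
Qed.

Let c1 := S * (T * (2 * al + 1) - 4 * S * al * (al + 1)).
Let r1 := (c + h) * h - 1.
Let mu := (m%:~R - c1) / (al * (al + 1)).
Let ka := (n%:~R^-1 - r1) / (al * d * (1 + 4 * al * d * S ^+ 2)).

Lemma geomz_tw_uV : geomz (tw_u a b)^-1 m =
  axlin al d (- X) 0 (-1) c1 (2 * S * (S * (2 * al + 1) - T)) mu.
Proof.
have P_neq0 : qsq al d (- X) 0 (-1) != 0.
  by rewrite PuE mulf_neq0 // (proj2 al_neq0).
have n2 : 2 != 0 :> L.
  by apply: contra n4 => /eqP n2; rewrite -[4]/((2 * 2)%N%:R) natrM n2 mul0r.
have PE : qsq al d (- (2 * X)) 0 (-2) = 4 * (al * (al + 1)).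
  by rewrite /qsq; ring.
have PV_neq0 : qsq al d (- (2 * X)) 0 (-2) != 0 by rewrite PE -PuE mulf_neq0.
rewrite uV geomz_qconj // PE.
(* The axis vector is halved to match [det_knot_core]. *)
have -> : axial al d (- (2 * X)) 0 (-2) = axial al d (2 * - X) (2 * 0) (2 * -1).
  by rewrite mulr0 mulrN mulrN1.
rewrite axial_scale // /axial PuE /mu.
have -> : S * (T * (2 * al + 1) - S * (4 * (al * (al + 1)))) = c1.
  by rewrite /c1; ring.
by congr axlin; ring.
Qed.

Lemma geomz_tw_w_div : geomz (tw_w a b m) n *
  axlin al d 0 (- (2 * X * al * S)) T r1 (4 * S * (c + h)) ka = tw_w a b m ^ n.
Proof.
have P_neq0 : qsq al d 0 (- (2 * X * al * S)) T != 0.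
  by rewrite PwE !mulf_neq0 // (proj2 al_neq0).
rewrite tw_wE -(geomz_qconj_div nrdw Pw_neq0 chebCc n_neq0); congr (_ * _).
have -> : axial al d 0 (- (8 * X * al * S ^+ 2)) (4 * T * S) =
    axial al d (4 * S * 0) (4 * S * - (2 * X * al * S)) (4 * S * T).
  have -> : 4 * S * - (2 * X * al * S) = - (8 * X * al * S ^+ 2) by ring.
  by rewrite mulr0 [4 * S * T]mulrAC.
rewrite axial_scale // /axial PwE /ka nrdw.
have -> : c * h + (h ^+ 2 - 1) = r1 by rewrite /r1; ring.
by [].
Qed.

Hypothesis det1_neq0 : (1 - t) * (t ^+ 2 - (x ^+ 2 - 2) * t + 1) != 0.

(** After multiplication by [det (1 - a)] the factored Fox derivative applies. Its bracket is [t^-1]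
    times a 3 by 3 matrix, whence [t^-3]. *)
Lemma det_fox_knot :
  \det (foxprod (gen_image a b) (gen_fox a b gen_a) (knot_relator m n)) =
  t ^- 3 * (t - 1) ^+ 2 * (t ^+ 2 - (x ^+ 2 - 2) * t + 1) / (D1 * D2) *
  ((m * n)%:~R * t ^+ 2
   - (adjcoefA m n y * x ^+ 4 + adjcoefB m n y * x ^+ 2 + adjcoefC m n y)
     / D3 * t
   + (m * n)%:~R).
Proof.
have detsub : \det (1 - a) != 0 by rewrite det_sub1_qA.
apply: (mulIf detsub); rewrite -det_mulmx mulmxE.
rewrite (fox_knot_relator Ua Ub tw_rep geomz_tw_w_div) -mulmxE !det_mulmx.
rewrite det_geomz_tw_w det_tw_u_exprz det_sub1_qA det_sub1_qB.
have T2 : T ^+ 2 = 1 + 4 * al * (al + 1) * S ^+ 2 by rewrite chebC_sqr; ring.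
have uVm : tw_u a b ^ (- m) = Q T (- (2 * S * X)) 0 (- (2 * S)).
  by rewrite -exprz_inv uV (quat_morph_exprz Qmorph) //; congr qconj; ring.
have bV : b^-1 = t^-1 *: Q X (-1) (-1) 0.
  by rewrite (invrZ Ut qB_unit) (proj2 (quat_morphV Qmorph (nrd_b _ _))) oppr0.
have dk := @det_knot_core L X al S T t mu ka T2.
have ck := @core_coefE L X al S T mu ka T2; cbv zeta in ck.
have mE : c1 + mu * (al * (al + 1)) = m%:~R.
  by rewrite divfK ?subrKC // mulf_neq0 // (proj2 al_neq0).
have nE : r1 + ka * (al * d * (1 + 4 * al * d * S ^+ 2)) = n%:~R^-1.
  by rewrite divfK ?subrKC // !mulf_neq0 // (proj2 al_neq0).
rewrite -/c1 -/r1 mE in dk; rewrite -/c1 -/r1 mE nE in ck.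
move: dk; set core := (_ + _); set g := core_coef _ _ _ _ _ _ => dk.
have -> : (b^-1 - 1) *m geomz (tw_u a b)^-1 m *m (1 - a) + tw_u a b ^ (- m) *m
    axlin al d 0 (- (2 * X * al * S)) T r1 (4 * S * (c + h)) ka = t^-1 *: core.
  rewrite bV geomz_tw_uV uVm !mulmxE /core scalerDr scalerA mulVf // scale1r.
  by rewrite !scalerAl scalerBr scalerA mulVf // scale1r.
rewrite detZ dk exprVn.
have SmE : T + (2 * al + 1) * S = chebS m y by rewrite /chebC subrK.
have TE : 2 * chebS m y - y * S = 2 * T by rewrite /chebC; ring.
rewrite SmE in ck; rewrite intrM /adjcoefA /adjcoefB /adjcoefC TE.
have den_neq0 : (al + 1) * (1 + 4 * al * d * S ^+ 2) != 0 by rewrite mulf_neq0.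
have -> : g = ((al + 1) * (1 + 4 * al * d * S ^+ 2))^-1
    * ((al + 1) * (1 + 4 * al * d * S ^+ 2) * g) by rewrite mulKf.
rewrite ck; field.
by rewrite D3_neq0 S_neq0 y2p_neq0 D2_neq0 D1_neq0 t_neq0 n_neq0 E3_neq0.
Qed.

Lemma knot_wada (j : 'I_2) :
  \det (foxprod (gen_image a b) (gen_fox a b (other j)) (knot_relator m n))
    / \det (1 - gen_image a b (j, false)) =
  (-1) ^+ (j == gen_b) * t ^- 3 *
  ((t - 1) / (D1 * D2) *
   ((m * n)%:~R * t ^+ 2
    - (adjcoefA m n y * x ^+ 4 + adjcoefB m n y * x ^+ 2 + adjcoefC m n y)
      / D3 * t
    + (m * n)%:~R)).
Proof.
(* The relator has value 1, so the derivatives times [1 - a] and [1 - b] are opposite; in dimension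
   3 this changes the sign of the determinant. *)
have fb : \det (foxprod (gen_image a b) (gen_fox a b gen_b) (knot_relator m n))
  = - \det (foxprod (gen_image a b) (gen_fox a b gen_a) (knot_relator m n)).
  have detb : \det (1 - b) != 0 by rewrite det_sub1_qB.
  apply: (mulIf detb); rewrite -det_mulmx mulmxE.
  have /eqP := fox_fundamental Ua Ub (knot_relator m n).
  rewrite (wordprod_knot_relator Ua Ub tw_rep) subrr addrC.
  rewrite addr_eq0 -!(opprB 1) !mulrN opprK => /eqP /(congr1 -%R).
  rewrite opprK => ->; rewrite -mulNr -mulmxE det_mulmx det_sub1_qA det_sub1_qB.
  by congr (_ * _); rewrite -scaleN1r detZ -signr_odd expr1 mulN1r.
have nt1 : 1 - t != 0 by apply: contra det1_neq0 => /eqP->; rewrite mul0r.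
have qt : t ^+ 2 - (x ^+ 2 - 2) * t + 1 != 0.
  by apply: contra det1_neq0 => /eqP->; rewrite mulr0.
case: (ord2_cases j) => ->; rewrite /other /gen_image /=.
  rewrite fb det_fox_knot det_sub1_qA; field.
  by rewrite D3_neq0 D2_neq0 D1_neq0 t_neq0 qt nt1.
rewrite det_fox_knot det_sub1_qB; field.
by rewrite D3_neq0 D2_neq0 D1_neq0 t_neq0 qt nt1.
Qed.

End KnotWada.

(** * The representation and its adjoint in quaternion coordinates *)

Section Representation.
Variable K : fieldType.
Hypothesis two_neq0 : 2 != 0 :> K.
Variables s y : K.
Hypothesis s_neq0 : s != 0.
Local Notation X := ((s + s^-1) / 2).
Local Notation al := ((y - 2) / 4).
Local Notation d := (al + 1 - X ^+ 2).
Local Notation dl := ((s - s^-1) / 2).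

Let n4 : 4 != 0 :> K.
Proof. by rewrite -[4]/((2 * 2)%N%:R) natrM mulf_neq0. Qed.

Lemma mul_mx2 p q r u p' q' r' u' : mx2 p q r u * mx2 p' q' r' u' =
  mx2 (p * p' + q * r') (p * q' + q * u') (r * p' + u * r') (r * q' + u * u')
  :> 'M[K]_2.
Proof.
apply/matrixP => -[[|[|?]] ?] -[[|[|?]] ?] //;
  by rewrite !mxE !big_ord_recl big_ord0 !mxE /= addr0.
Qed.

Lemma one_mx2 : 1 = mx2 1 0 0 1 :> 'M[K]_2.
Proof. by apply/matrixP => -[[|[|?]] ?] -[[|[|?]] ?] //; rewrite !mxE. Qed.

Lemma inv_mx2 p q r u : p * u - q * r = 1 ->
  (mx2 p q r u)^-1 = mx2 u (- q) (- r) p :> 'M[K]_2.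
Proof.
move=> det1.
have rV : mx2 p q r u * mx2 u (- q) (- r) p = 1.
  by rewrite mul_mx2 one_mx2 -det1; congr mx2; ring.
have lV : mx2 u (- q) (- r) p * mx2 p q r u = 1.
  by rewrite mul_mx2 one_mx2 -det1; congr mx2; ring.
have U : mx2 p q r u \is a GRing.unit.
  by apply/unitrP; exists (mx2 u (- q) (- r) p).
by apply: (mulrI U); rewrite rV mulrV.
Qed.

(* [i = (rho b - rho a) / 2], [j = (rho a + rho b) / 2 - X], [k = j i] *)
Definition quat_mx2 g0 g1 g2 g3 : 'M[K]_2 :=
  mx2 (g0 + dl * g2 - al * g3) ((g2 - g1 - dl * g3) / 2)
      (2 * al * (dl * g3 - g1 - g2)) (g0 - dl * g2 + al * g3).

Lemma quat_mx2_morph : quat_morph al d quat_mx2.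
Proof.
split=> [|*]; first by rewrite one_mx2; congr mx2; ring.
by rewrite mul_mx2; congr mx2; field; rewrite ?n4 ?s_neq0 ?two_neq0.
Qed.

Lemma rho_aE : rho_J s y gen_a = quat_mx2 X (-1) 1 0.
Proof. by congr mx2; field; rewrite ?n4 ?s_neq0 ?two_neq0. Qed.

Lemma rho_bE : rho_J s y gen_b = quat_mx2 X 1 1 0.
Proof. by congr mx2; field; rewrite ?n4 ?s_neq0 ?two_neq0. Qed.

Lemma eval_wordE w : eval_word (rho_J s y) w =
  wordprod (gen_image (rho_J s y gen_a) (rho_J s y gen_b)) w.
Proof.
by elim: w => [|[i e] w IH] //=; rewrite IH; congr (_ *m _).
Qed.

Lemma knot_rep_cheb m n : is_knot_rep m n (rho_J s y) ->
  let S := chebS (m - 1) (2 * (2 * al + 1)) in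
  let h := 1 + 8 * al * d * S ^+ 2 in
  chebC n h = chebS (n - 1) (2 * h) * (4 * chebC m (2 * al + 1) * S * d).
Proof.
have morph := quat_mx2_morph.
have [Ua _] := quat_morphV morph (nrd_a X al).
have [Ub _] := quat_morphV morph (nrd_b X al).
rewrite -rho_aE in Ua; rewrite -rho_bE in Ub.
rewrite /is_knot_rep eval_wordE.
rewrite (wordprod_pow (gen_image_unit Ua Ub) (gen_image_inv _ _)).
rewrite (wordprod_knot_w Ua Ub) !mulmxE rho_aE rho_bE.
rewrite (quat_tw_w morph) (quat_morph_exprz morph _ (nrd_w X al m)).
(* The difference [w^n a - b w^n] is [a - b] times the scalar that must vanish, and the upper right
   entry of [a - b] is 1. *)
rewrite !(proj2 morph) => /matrixP/(_ ord0 ord_max); rewrite !mxE /= => rel.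
cbv zeta; apply/eqP; rewrite -subr_eq0; apply/eqP.
move/eqP: rel; rewrite -subr_eq0 => /eqP <-.
by field; rewrite ?n4 ?s_neq0 ?two_neq0.
Qed.

(** Its columns are the coordinates of [2 i], [2 j], [2 k] in the basis [E, H, F] of sl_2. *)
Definition quat_basis : 'M[K]_3 :=
  mx3 (-1) 1 (- dl) 0 (2 * dl) (- (2 * al)) (- (4 * al)) (- (4 * al))
      (4 * al * dl).

Lemma det_quat_basis : \det quat_basis = (y - 2) * (4 * d).
Proof. by rewrite det_mx3; field; rewrite ?n4 ?s_neq0 ?two_neq0. Qed.

Lemma Ad_mx2 p q r u : p * u - q * r = 1 ->
  Ad (mx2 p q r u) = mx3 (p ^+ 2) (- 2 * p * q) (- q ^+ 2)
    (- p * r) (p * u + q * r) (q * u) (- r ^+ 2) (2 * r * u) (u ^+ 2)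
  :> 'M[K]_3.
Proof.
move=> det1; apply/matrixP => i j; rewrite !mxE.
rewrite -[invmx _]/((mx2 p q r u)^-1) inv_mx2 // !mulmxE.
by case: i => -[|[|[|?]]] ? //; case: j => -[|[|[|?]]] ? //;
  rewrite /sl2_coord /sl2_basis /= !mul_mx2 !mxE /=; ring.
Qed.

Lemma Ad_rho_a : Ad (rho_J s y gen_a) * quat_basis = quat_basis * qA X al.
Proof.
rewrite /rho_J /= Ad_mx2; last by field.
rewrite /qA /qconj /axlin !mul_mx3 /qsq.
by congr mx3; field; rewrite ?n4 ?s_neq0 ?two_neq0.
Qed.

Lemma Ad_rho_b : Ad (rho_J s y gen_b) * quat_basis = quat_basis * qB X al.
Proof.
rewrite /rho_J /= Ad_mx2; last by field.
rewrite /qB /qconj /axlin !mul_mx3 /qsq.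
by congr mx3; field; rewrite ?n4 ?s_neq0 ?two_neq0.
Qed.

End Representation.

(** * Transport along field morphisms, and rational functions *)

Section Morphisms.
Variables (K L : fieldType) (f : {rmorphism K -> L}).

Lemma rmorph_chebS k (v : K) : f (chebS k v) = chebS k (f v).
Proof.
have nat_case i : f (chebS_nat v i) = chebS_nat (f v) i.
  suff [] : f (chebS_nat v i) = chebS_nat (f v) i
    /\ f (chebS_nat v i.+1) = chebS_nat (f v) i.+1 by [].
  elim: i => [|i [IH1 IH2]]; first by rewrite /= rmorph1.
  split=> //.
  rewrite -[chebS_nat v i.+2]/(v * chebS_nat v i.+1 - chebS_nat v i).
  by rewrite rmorphB rmorphM IH1 IH2.
by case: k => [k|[|k]] /=; rewrite ?rmorph0 ?rmorphN ?nat_case.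
Qed.

Lemma rmorph_chebC k (h : K) : f (chebC k h) = chebC k (f h).
Proof. by rewrite /chebC rmorphB !rmorphM !rmorph_chebS rmorphM rmorph_nat. Qed.

Lemma rmorph_adjcoefA m n (y : K) : f (adjcoefA m n y) = adjcoefA m n (f y).
Proof.
rewrite /adjcoefA -!rmorph_chebS rmorphM fmorph_div.
by congr (_ * (_ / _)); ring.
Qed.

Lemma rmorph_adjcoefB m n (y : K) : f (adjcoefB m n y) = adjcoefB m n (f y).
Proof.
rewrite /adjcoefB -!rmorph_chebS 3!rmorphD.
rewrite [f (_ * (_ / _))]rmorphM fmorph_div.
by congr (_ * (_ / _) + _ + _ + _); ring. Qed.

Lemma rmorph_adjcoefC m n (y : K) : f (adjcoefC m n y) = adjcoefC m n (f y).
Proof. by rewrite /adjcoefC -!rmorph_chebS; ring. Qed.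

Lemma map_mx3 a b c d e g h i j :
  map_mx f (mx3 a b c d e g h i j) =
  mx3 (f a) (f b) (f c) (f d) (f e) (f g) (f h) (f i) (f j).
Proof.
by apply/matrixP => -[[|[|[|?]]] ?] -[[|[|[|?]]] ?] //; rewrite !mxE.
Qed.

Lemma map_qA (X al : K) : map_mx f (qA X al) = qA (f X) (f al).
Proof. by rewrite /qA /qconj /axlin map_mx3 /qsq; congr mx3; ring. Qed.

Lemma map_qB (X al : K) : map_mx f (qB X al) = qB (f X) (f al).
Proof. by rewrite /qB /qconj /axlin map_mx3 /qsq; congr mx3; ring. Qed.

End Morphisms.

Section Fractions.
Variable K : fieldType.
Local Notation FF := {fraction {poly K}}.

HB.instance Definition _ := GRing.RMorphism.copy (@cstF K)
  (@FracField.tofrac {poly K} \o polyC).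

Lemma tvar_neq0 : tvar K != 0.
Proof. by rewrite tofrac_eq0 polyX_eq0. Qed.

Lemma tvar_char_neq0 (c : K) :
  (1 - tvar K) * (tvar K ^+ 2 - cstF c * tvar K + 1) != 0.
Proof.
rewrite -[tvar K]/(FracField.tofrac 'X) -[cstF c]/(FracField.tofrac c%:P).
rewrite -!(tofrac1, tofracB, tofracM, tofracD, tofracXn) tofrac_eq0.
(* The constant coefficient of this polynomial is 1. *)
apply/eqP => /(congr1 (horner^~ 0)); rewrite !hornerE.
rewrite /= expr2 !mulr0 subr0 add0r mul1r oppr0 add0r => /eqP.
by rewrite oner_eq0.
Qed.

End Fractions.

(** * Invariance of Wada's quotient under change of basis *)

Lemma scaled_letter_conj (L : fieldType) (k : nat) (t : L)
    (s M C : 'M[L]_k.+1) (e : bool) : t != 0 ->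
  C \is a GRing.unit -> M \is a GRing.unit -> s * C = C * M ->
  (if e then t^-1 *: invmx s else t *: s) * C
  = C * (if e then (t *: M)^-1 else t *: M).
Proof.
move=> t0 UC UM sC; case: e; last by rewrite -scalerAl sC scalerAr.
have sE : s = C * M * C^-1 by rewrite -sC mulrK.
rewrite invrZ ?unitfE // -[invmx s]/(s^-1) sE.
rewrite !invrM ?unitrV ?unitrMl // invrK -scalerAl -scalerAr.
by rewrite !mulrA mulrVK.
Qed.

Lemma det_conj (L : fieldType) (k : nat) (X Y C : 'M[L]_k.+1) :
  C \is a GRing.unit -> X * C = C * Y -> \det X = \det Y.
Proof.
move=> UC XC; have detC : \det C != 0 by rewrite -unitfE -unitmxE.
by apply: (mulIf detC); rewrite -!det_mulmx mulmxE XC -mulmxE !det_mulmx mulrC.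
Qed.

Section WadaConjugation.
Variable K : fieldType.
Local Notation FF := {fraction {poly K}}.
Variables (k : nat) (sigma : 'I_2 -> 'M[FF]_k.+1) (A B C : 'M[FF]_k.+1).
Hypothesis C_unit : C \is a GRing.unit.
Local Notation a := (tvar K *: A).
Local Notation b := (tvar K *: B).
Hypotheses (Ua : A \is a GRing.unit) (Ub : B \is a GRing.unit).
Hypotheses (sigma_a : sigma gen_a * C = C * A).
Hypotheses (sigma_b : sigma gen_b * C = C * B).

Lemma Phi_letter_conj l : Phi_letter sigma l * C = C * gen_image a b l.
Proof.
case: l => i e; have t0 := tvar_neq0 K; case: (ord2_cases i) => ->.
  exact: (scaled_letter_conj e t0 C_unit Ua sigma_a).
exact: (scaled_letter_conj e t0 C_unit Ub sigma_b).
Qed.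

Lemma fox_conj j w :
  fox sigma j w * C = C * foxprod (gen_image a b) (gen_fox a b j) w.
Proof.
elim: w => [|l w IH]; first by rewrite mul0r mulr0.
rewrite [fox _ _ _]/= [foxprod _ _ _]/= mulmxE mulrDl mulrDr -mulrA IH.
rewrite mulrA Phi_letter_conj -mulrA.
congr (_ + _); rewrite /fox_letter /gen_fox; case: (l.1 == j); last first.
  by rewrite mul0r mulr0.
case: l.2; last by rewrite mul1r mulr1.
by rewrite mulNr mulrN Phi_letter_conj.
Qed.

Lemma wada2_conj r j : wada2 sigma r j =
  \det (foxprod (gen_image a b) (gen_fox a b (other j)) r)
  / \det (1 - gen_image a b (j, false)).
Proof.
rewrite /wada2; congr (_ / _); apply: (det_conj C_unit); first exact: fox_conj.
by rewrite mulrBl mul1r Phi_letter_conj mulrBr mulr1.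
Qed.

End WadaConjugation.

(** * From the field of the representation to that of [t], and conclusion *)

Section ScalarExtension.
Variables (K L : fieldType) (f : {rmorphism K -> L}) (t : L).
Variables (m n : int) (s y : K).
Local Notation x := (s + s^-1).
Local Notation X := (x / 2).
Local Notation al := ((y - 2) / 4).
Local Notation S := (chebS (m - 1) y).
Local Notation D1 := (y + 2 - x ^+ 2).
Local Notation D2 := (4 - x ^+ 2 + (y - 2) * D1 * S ^+ 2).
Local Notation D3 := (4 + (y - 2) * D1 * S ^+ 2).
Local Notation a := (t *: qA (f X) (f al)).
Local Notation b := (t *: qB (f X) (f al)).
Hypothesis two_neq0 : 2 != 0 :> K.
Hypotheses (s_neq0 : s != 0) (y_neq2 : y != 2) (D1_neq0 : D1 != 0).

Let n4 : 4 != 0 :> K.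
Proof. by rewrite -[4]/((2 * 2)%N%:R) natrM mulf_neq0. Qed.

Lemma map_quat_basis_unit : map_mx f (quat_basis s y) \is a GRing.unit.
Proof.
rewrite -[_ \is a GRing.unit]/(_ \in unitmx) unitmxE unitfE det_map_mx.
rewrite fmorph_eq0 det_quat_basis // mulf_neq0 ?subr_eq0 //.
suff -> : 4 * (al + 1 - X ^+ 2) = D1 by [].
by field; rewrite n4 s_neq0 two_neq0.
Qed.

Lemma map_Ad_rho_a : map_mx f (Ad (rho_J s y gen_a)) * map_mx f (quat_basis s y)
  = map_mx f (quat_basis s y) * qA (f X) (f al).
Proof.
by rewrite -map_qA -mulmxE -!map_mxM; congr map_mx; exact: Ad_rho_a.
Qed.

Lemma map_Ad_rho_b : map_mx f (Ad (rho_J s y gen_b)) * map_mx f (quat_basis s y)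
  = map_mx f (quat_basis s y) * qB (f X) (f al).
Proof.
by rewrite -map_qB -mulmxE -!map_mxM; congr map_mx; exact: Ad_rho_b.
Qed.

Hypotheses (n_neq0 : n%:~R != 0 :> K) (y2_neq0 : y + 2 != 0).
Hypotheses (S_neq0 : S != 0) (D2_neq0 : D2 != 0) (D3_neq0 : D3 != 0).
Hypothesis t_neq0 : t != 0.
Hypothesis det1_neq0 : (1 - t) * (t ^+ 2 - f (x ^+ 2 - 2) * t + 1) != 0.
Hypothesis rep : is_knot_rep m n (rho_J s y).

Lemma knot_wada_ext (j : 'I_2) :
  \det (foxprod (gen_image a b) (gen_fox a b (other j)) (knot_relator m n))
    / \det (1 - gen_image a b (j, false)) =
  (-1) ^+ (j == gen_b) * t ^- 3 *
  ((t - 1) / f (D1 * D2) *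
   (f (m * n)%:~R * t ^+ 2
    - f ((adjcoefA m n y * x ^+ 4 + adjcoefB m n y * x ^+ 2
          + adjcoefC m n y) / D3) * t
    + f (m * n)%:~R)).
Proof.
have xE : 2 * X = x by rewrite mulrC divfK.
have yE : 2 * (2 * al + 1) = y by field; rewrite ?n4 ?two_neq0.
have fx : 2 * f X = f x by rewrite -[in RHS]xE; ring.
have fy : 2 * (2 * f al + 1) = f y by rewrite -[in RHS]yE; ring.
have fS : chebS (m - 1) (f y) = f S by rewrite rmorph_chebS.
have fD1 : f y + 2 - f x ^+ 2 = f D1 by ring.
have fD2 : 4 - f x ^+ 2 + (f y - 2) * f D1 * f S ^+ 2 = f D2 by ring.
have fD3 : 4 + (f y - 2) * f D1 * f S ^+ 2 = f D3 by ring.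
have fx2 : f x ^+ 2 - 2 = f (x ^+ 2 - 2) by ring.
have fal : f y - 2 = f (y - 2) by ring.
have fy2 : f y + 2 = f (y + 2) by ring.
have fne (c : K) : c != 0 -> f c != 0 by rewrite fmorph_eq0.
have fn_neq0 : n%:~R != 0 :> L by rewrite -(rmorph_int f) fmorph_eq0.
have al_neq0 : y - 2 != 0 by rewrite subr_eq0.
(* The representation lives over [K]: its Chebyshev condition is obtained there, then mapped to
   [L]. *)
have chebCc := congr1 f (knot_rep_cheb two_neq0 s_neq0 rep).
have := @knot_wada L (f X) (f al) t m n t_neq0.
rewrite fy fx fS fD1 fD2 fD3 fal fy2 fx2 => wada.
rewrite wada ?fne //; last first.
  move: chebCc fy; rewrite -fS; move: X al => X' al' chebCc <-; move: chebCc.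
  by rewrite !(rmorph_nat, rmorphXn, rmorph1, rmorphN, rmorphM, rmorphD,
    rmorph_chebC, rmorph_chebS).
rewrite (rmorphM f D1 D2) fmorph_div rmorph_int -rmorph_adjcoefA.
rewrite -rmorph_adjcoefB -rmorph_adjcoefC.
set A := adjcoefA m n y; set B := adjcoefB m n y; set C := adjcoefC m n y.
have -> // : f (A * x ^+ 4 + B * x ^+ 2 + C)
    = f A * f x ^+ 4 + f B * f x ^+ 2 + f C.
by move: A B C => A B C; ring.
Qed.

End ScalarExtension.

(** Conjugation by [quat_basis] replaces the adjoint images by [qA] and [qB], in which [s] enters
    only through [x]. *)
Lemma adjoint_wada (K : fieldType) (m n : int) (s y : K) (j : 'I_2) :
  2 != 0 :> K -> n%:~R != 0 :> K ->
  s != 0 -> y != 2 -> is_knot_rep m n (rho_J s y) ->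
  let x := s + s^-1 in
  let S := chebS (m - 1) y in
  let D1 := y + 2 - x ^+ 2 in
  let D2 := 4 - x ^+ 2 + (y - 2) * D1 * S ^+ 2 in
  let D3 := 4 + (y - 2) * D1 * S ^+ 2 in
  y + 2 != 0 -> S != 0 -> D1 != 0 -> D2 != 0 -> D3 != 0 ->
  let t := tvar K in
  wada2 (Ad_images (rho_J s y)) (knot_relator m n) j =
  (-1) ^+ (j == gen_b) * t ^- 3 *
  ((t - 1) / cstF (D1 * D2) *
   (cstF (m * n)%:~R * t ^+ 2
    - cstF ((adjcoefA m n y * x ^+ 4 + adjcoefB m n y * x ^+ 2
             + adjcoefC m n y) / D3) * t
    + cstF (m * n)%:~R)).
Proof.
move=> two0 n0 s0 y2 rep x S D1 D2 D3 y20 S0 D10 D20 D30 t.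
pose f : {rmorphism K -> {fraction {poly K}}} := @cstF K.
rewrite (wada2_conj (map_quat_basis_unit f two0 s0 y2 D10)
  (qA_unit _ _) (qB_unit _ _)
  (map_Ad_rho_a f y two0 s0) (map_Ad_rho_b f y two0 s0)).
exact: (knot_wada_ext (f := f) two0 s0 y2 D10 n0 y20 S0 D20 D30 (tvar_neq0 K)
  (tvar_char_neq0 _) rep j).
Qed.

Theorem theorem1p1 (R : realType) (m n : int) (s y : R[i]) (j : 'I_2) :
  m * n != 0 ->
  s != 0 -> y != 2 ->
  (* rho is a (nonabelian) representation of the knot group *)
  is_knot_rep m n (rho_J s y) ->
  (* the denominators occurring in the formula are nonzero *)
  let x := s + s^-1 in
  let Sm1 := chebS (m - 1) y in
  let D1 := y + 2 - x ^+ 2 in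
  let D2 := 4 - x ^+ 2 + (y - 2) * D1 * Sm1 ^+ 2 in
  let D3 := 4 + (y - 2) * D1 * Sm1 ^+ 2 in
  y + 2 != 0 -> Sm1 != 0 -> D1 != 0 -> D2 != 0 -> D3 != 0 ->
  let t := tvar R[i] in
  let mn : R[i] := (m * n)%:~R in
  exists (e : bool) (l : int),
    wada2 (Ad_images (rho_J s y)) (knot_relator m n) j
    = (-1) ^+ e * t ^ (3 * l)
      * ((t - 1) / cstF (D1 * D2)
         * (cstF mn * t ^+ 2
            - cstF ((adjcoefA m n y * x ^+ 4 + adjcoefB m n y * x ^+ 2
                     + adjcoefC m n y) / D3) * t
            + cstF mn)).
Proof.
move=> mn0 s0 y2 rep x Sm1 D1 D2 D3 y20 S0 D10 D20 D30 t mn.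
have two0 : 2 != 0 :> R[i] by rewrite pnatr_eq0.
have n0 : n%:~R != 0 :> R[i].
  by rewrite intr_eq0; apply: contra mn0 => /eqP->; rewrite mulr0.
(* The sign depends on the deleted column; the exponent comes from [t^-3]. *)
exists (j == gen_b), (-1).
exact: (adjoint_wada j two0 n0 s0 y2 rep y20 S0 D10 D20 D30).
Qed.
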